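(* Let $q\in\mathbb{C}$ with $|q|<1$. For $a,b\in\mathbb{N}$ with $a\equiv 1 \pmod 2$ and $b\equiv 1\pmod 2$, $$[2]_{q^b}\,[b]_q^s\sum_{j=0}^{a-1}(-1)^jq^{bj}\,\zeta_{E,q^a}\!\left(s,\,bx+\frac{bj}{a}\right)=[2]_{q^a}\,[a]_q^s\sum_{j=0}^{b-1}(-1)^jq^{aj}\,\zeta_{E,q^b}\!\left(s,\,ax+\frac{aj}{b}\right),$$ where $s\in\mathbb{C}$ and $x$ is such that the second arguments of the zeta functions occurring are not in $\{0,-1,-2,\ldots\}$.
   Context: For $q\in\mathbb{C}$ with $|q|<1$ and any complex number $x$, the $q$-analogue of $x$ is $[x]_q=\frac{1-q^x}{1-q}$. Put $F_q(t,x)=[2]_q\sum_{n=0}^{\infty}(-1)^nq^ne^{[n+x]_qt}$. The $q$-Euler zeta function is $$\zeta_{E,q}(s,x)=\frac{1}{\Gamma(s)}\int_0^\infty t^{s-1}F_q(-t,x)\,dt=[2]_q\sum_{n=0}^{\infty}\frac{(-1)^nq^n}{[n+x]_q^s},$$ where $x\neq 0,-1,-2,\ldots$ and $s\in\mathbb{C}$. The notations $[\,\cdot\,]_{q^a}$, $\zeta_{E,q^a}$, $[\,\cdot\,]_{q^b}$, $\zeta_{E,q^b}$ mean the same objects with $q$ replaced by $q^a$, respectively $q^b$.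
   Formalization: Branches are fixed, as the identity fails for principal ones: q^x uses any fixed logarithm l of q, and (q^a)^x means q^{ax}; [y]_q^s means (1-q^y)^s/(1-q)^s with principal powers, which is the principal power of [y]_q if Re [y]_q>0 or |q^y|<1. *)

(* Defs.v *)
From Stdlib Require Import Reals Lra Lia.
From Coquelicot Require Import Coquelicot.

Open Scope R_scope.
Open Scope C_scope.

Definition Cexp (z : C) : C :=
  ((exp (Re z) * cos (Im z))%R, (exp (Re z) * sin (Im z))%R).

(* Principal argument, in (-PI, PI]; [Carg 0] is a dummy value. *)
Definition Carg (z : C) : R :=
  if Rlt_dec (Im z) 0 then (- acos (Re z / Cmod z))%R
  else acos (Re z / Cmod z).

Definition Clog (z : C) : C := (ln (Cmod z), Carg z).

(* Principal value of [w ^ s], extended by [0 ^ s = 0]. *)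
Definition Cpower (w s : C) : C :=
  if Ceq_dec w 0 then 0 else Cexp (s * Clog w).

(* The complex powers [q ^ x] depend on the choice of a logarithm of [q].  A
   base is therefore given by [q] together with [l] such that [Cexp l = q];
   the base [q ^ a] is then ([q ^ a], [a * l]), so that [(q ^ a) ^ x] is
   [q ^ (a * x)].  For [q = 0], which has no logarithm, [0 ^ x] is [0] for
   [x <> 0] and [0 ^ 0] is [1], and [l] plays no role. *)
Definition is_log (q l : C) : Prop := q <> 0 -> Cexp l = q.

Definition qpow (q l x : C) : C :=
  if Ceq_dec q 0 then (if Ceq_dec x 0 then 1 else 0) else Cexp (x * l).

Definition qnum (q l x : C) : C := (1 - qpow q l x) / (1 - q).

(* The power [[x]_q ^ s], on the branch given by the quotient of the principal
   values of [(1 - q ^ x) ^ s] and [(1 - q) ^ s].  For [|q| < 1] this is the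
   principal value of [[x]_q ^ s] whenever [[x]_q] has positive real part or
   [|q ^ x| < 1], see [qnum_power_principal] and [qnum_power_principal_lt1].
   Outside these regions the principal value can fail to satisfy
   [[a * x]_q ^ s = [a]_q ^ s * [x]_(q ^ a) ^ s], while this branch does. *)
Definition qnum_power (q l x s : C) : C :=
  Cpower (1 - qpow q l x) s / Cpower (1 - q) s.

Definition CSeries (u : nat -> C) : C :=
  (Series (fun n => Re (u n)), Series (fun n => Im (u n))).

Definition zetaE (q l s x : C) : C :=
  qnum q l 2 *
  CSeries (fun n => (-1) ^ n * q ^ n / qnum_power q l (INR n + x) s).

Lemma Cexp_plus (z w : C) : Cexp (z + w) = Cexp z * Cexp w.
Proof.
destruct z as [a b], w as [c d]; unfold Cexp, Cmult; cbn.
rewrite exp_plus, cos_plus, sin_plus; f_equal; ring.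
Qed.

Lemma Cmod_Cexp (z : C) : Cmod (Cexp z) = exp (Re z).
Proof.
destruct z as [a b]; unfold Cexp, Cmod; cbn [fst snd Re Im].
replace (_ + _)%R with (Rsqr (exp a) * (Rsqr (sin b) + Rsqr (cos b)))%R
  by (unfold Rsqr; ring).
rewrite sin2_cos2, Rmult_1_r; apply sqrt_Rsqr, Rlt_le, exp_pos.
Qed.

Lemma Cexp_neq_0 (z : C) : Cexp z <> 0.
Proof.
apply Cmod_gt_0; rewrite Cmod_Cexp; apply exp_pos.
Qed.

Lemma Cexp_Clog (z : C) : z <> 0 -> Cexp (Clog z) = z.
Proof.
intros Hz; assert (Hm : 0 < Cmod z) by now apply Cmod_gt_0.
assert (H2 : (Cmod z * Cmod z = Re z * Re z + Im z * Im z)%R).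
{ generalize (Cmod2_alt z); simpl; lra. }
set (t := (Re z / Cmod z)%R).
assert (Ht2 : (1 - Rsqr t = Rsqr (Im z / Cmod z))%R).
{ unfold t, Rsqr; replace 1%R with ((Cmod z * Cmod z) / (Cmod z * Cmod z))%R
    by (field; lra).
  rewrite H2 at 1; field; lra. }
assert (Ht : -1 <= t <= 1).
{ assert (Rsqr t <= 1) by (generalize (Rle_0_sqr (Im z / Cmod z)); lra).
  unfold Rsqr in *; split; nra. }
assert (Hs : sin (acos t) = (Rabs (Im z) / Cmod z)%R).
{ rewrite sin_acos, Ht2, sqrt_Rsqr_abs by easy.
  unfold Rdiv; rewrite Rabs_mult, (Rabs_right (/ Cmod z)); trivial.
  apply Rle_ge, Rlt_le, Rinv_0_lt_compat; easy. }
unfold Cexp, Clog, Carg; cbn [Re Im fst snd]; rewrite exp_ln by easy.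
fold t; destruct z as [a b]; cbn [Re Im fst snd] in *.
destruct (Rlt_dec b 0) as [Hb|Hb].
- rewrite cos_neg, sin_neg, cos_acos, Hs, Rabs_left by easy.
  f_equal; unfold t; field; lra.
- rewrite cos_acos, Hs, Rabs_right by lra.
  f_equal; unfold t; field; lra.
Qed.

Lemma Clog_Cexp (z : C) : - PI < Im z < PI -> Clog (Cexp z) = z.
Proof.
intros Hz; unfold Clog; rewrite Cmod_Cexp, ln_exp.
unfold Carg; rewrite Cmod_Cexp.
destruct z as [a b]; unfold Cexp; cbn [Re Im fst snd] in *.
assert (He := exp_pos a).
replace (exp a * cos b / exp a)%R with (cos b) by (field; lra).
destruct (Rlt_dec _ _) as [Hs|Hs]; f_equal.
- assert (b < 0).
  { apply Rnot_le_lt; intros Hb.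
    assert (0 <= sin b) by (apply sin_ge_0; lra); nra. }
  rewrite <- cos_neg, acos_cos by lra; ring.
- assert (0 <= b).
  { apply Rnot_lt_le; intros Hb.
    assert (0 < sin (- b)) by (apply sin_gt_0; lra).
    rewrite sin_neg in *; nra. }
  apply acos_cos; lra.
Qed.

Lemma Carg_bound (z : C) : 0 < Re z -> - (PI / 2) < Carg z < PI / 2.
Proof.
intros Hr.
assert (Hz : z <> 0) by (intros ->; cbn in Hr; lra).
assert (Hm : 0 < Cmod z) by now apply Cmod_gt_0.
assert (H1 : Re (Cexp (Clog z)) = Re z) by now rewrite Cexp_Clog.
unfold Cexp, Clog in H1; cbn [Re Im fst snd] in H1.
rewrite exp_ln in H1 by easy.
assert (Hc : 0 < cos (Carg z)).
{ apply Rnot_le_lt; intros Hc; unfold Re in *; nra. }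
generalize (acos_bound (Re z / Cmod z)); intros Ha.
assert (acos (Re z / Cmod z) < PI / 2).
{ apply Rnot_le_lt; intros Hp.
  assert (cos (acos (Re z / Cmod z)) <= 0) by (apply cos_le_0; lra).
  unfold Carg in Hc; destruct (Rlt_dec _ _); [rewrite cos_neg in Hc|]; lra. }
unfold Carg; destruct (Rlt_dec _ _); lra.
Qed.

Lemma Clog_mult (v w : C) :
  0 < Re v -> 0 < Re w -> Clog (v * w) = Clog v + Clog w.
Proof.
intros Hv Hw.
assert (v <> 0) by (intros ->; cbn in Hv; lra).
assert (w <> 0) by (intros ->; cbn in Hw; lra).
rewrite <- (Cexp_Clog v), <- (Cexp_Clog w) at 1 by easy.
rewrite <- Cexp_plus, Clog_Cexp; trivial.
generalize (Carg_bound v Hv) (Carg_bound w Hw).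
rewrite im_plus; unfold Clog; cbn [Im snd]; lra.
Qed.

Lemma Clog_div (v w : C) :
  0 < Re v -> 0 < Re w -> Clog (v / w) = Clog v - Clog w.
Proof.
intros Hv Hw.
assert (v <> 0) by (intros ->; cbn in Hv; lra).
assert (w <> 0) by (intros ->; cbn in Hw; lra).
assert (E : v / w = Cexp (Clog v - Clog w)).
{ rewrite <- (Cexp_Clog v) at 1 by easy.
  replace (Clog v) with ((Clog v - Clog w) + Clog w) at 1 by ring.
  rewrite Cexp_plus, (Cexp_Clog w) by easy; field; easy. }
rewrite E, Clog_Cexp; trivial.
generalize (Carg_bound v Hv) (Carg_bound w Hw).
unfold Cminus; rewrite im_plus, im_opp; unfold Clog; cbn [Im snd]; lra.
Qed.

Lemma Cpower_mult (v w s : C) :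
  0 < Re v -> 0 < Re w -> Cpower (v * w) s = Cpower v s * Cpower w s.
Proof.
intros Hv Hw.
assert (v <> 0) by (intros ->; cbn in Hv; lra).
assert (w <> 0) by (intros ->; cbn in Hw; lra).
unfold Cpower.
destruct (Ceq_dec (v * w) 0) as [E|_].
{ now elim (Cmult_neq_0 v w). }
destruct (Ceq_dec v 0); [easy|]; destruct (Ceq_dec w 0); [easy|].
rewrite Clog_mult, Cmult_plus_distr_l, Cexp_plus by easy; easy.
Qed.

Lemma Re_1_minus_pos (z : C) : Cmod z < 1 -> 0 < Re (1 - z).
Proof.
intros Hz; generalize (re_le_Cmod z) (Rle_abs (Re z)).
destruct z as [a b]; cbn in *; lra.
Qed.

Lemma Cpower_neq_0 (w s : C) : w <> 0 -> Cpower w s <> 0.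
Proof.
intros Hw; unfold Cpower; destruct (Ceq_dec w 0); [easy|].
apply Cexp_neq_0.
Qed.

Lemma qnum_power_1 (q l x : C) : qnum_power q l x 1 = qnum q l x.
Proof.
unfold qnum_power, qnum.
assert (H : forall w, Cpower w 1 = w).
{ intros w; unfold Cpower; destruct (Ceq_dec w 0) as [->|Hw]; trivial.
  rewrite Cmult_1_l; now apply Cexp_Clog. }
now rewrite !H.
Qed.

Lemma qnum_power_principal (q l x s : C) :
  Cmod q < 1 -> 0 < Re (qnum q l x) ->
  qnum_power q l x s = Cpower (qnum q l x) s.
Proof.
intros Hq Hx; apply Re_1_minus_pos in Hq.
assert (H : 1 - q <> 0) by (intros E; rewrite E in Hq; cbn in Hq; lra).
unfold qnum_power.
replace (1 - qpow q l x) with (qnum q l x * (1 - q))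
  by (unfold qnum; field; easy).
rewrite Cpower_mult by easy; field; now apply Cpower_neq_0.
Qed.

Lemma qnum_power_principal_lt1 (q l x s : C) :
  Cmod q < 1 -> Cmod (qpow q l x) < 1 ->
  qnum_power q l x s = Cpower (qnum q l x) s.
Proof.
intros Hq Hx; apply Re_1_minus_pos in Hq; apply Re_1_minus_pos in Hx.
assert (H : 1 - q <> 0) by (intros E; rewrite E in Hq; cbn in Hq; lra).
unfold qnum_power, qnum.
set (u := 1 - qpow q l x) in *; set (v := 1 - q) in *.
assert (Hu : u <> 0) by (intros E; rewrite E in Hx; cbn in Hx; lra).
assert (Huv : u / v <> 0).
{ intros E; apply Hu; replace u with (u / v * v) by (field; easy).
  rewrite E; ring. }
unfold Cpower.
destruct (Ceq_dec u 0); [easy|]; destruct (Ceq_dec v 0); [easy|].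
destruct (Ceq_dec (u / v) 0); [easy|].
rewrite Clog_div by easy.
replace (s * Clog u) with (s * (Clog u - Clog v) + s * Clog v) by ring.
rewrite Cexp_plus; field; apply Cexp_neq_0.
Qed.

(* Main.v *)
Require Import Defs.
From Stdlib Require Import Reals Lra Lia.
From Coquelicot Require Import Coquelicot.

(** Expanding the zeta functions, the left-hand side is a factor symmetric in
    [a] and [b] times the sum over [j < a] and [n] of
    [(-1) ^ (n + j) * h (a * n + b * j)], where
    [h k = q ^ k / (1 - q ^ (k + a * b * x)) ^ s].  Writing [n = b * m + i] with
    [i < b], the sign becomes [(-1) ^ (m + i + j)] because [b] is odd, and the
    argument of [h] becomes [a * b * m + a * i + b * j]: the triple sum over
    [i < b], [j < a] and [m] is symmetric under exchanging [(a, j)] and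
    [(b, i)].  The rearrangement is legitimate because [|h k|] is at most a
    constant times [|q| ^ k]. *)

Open Scope R_scope.
Open Scope C_scope.

(** * Series split along residue classes *)

Lemma sum_n_add {G : AbelianMonoid} (u : nat -> G) (n p : nat) :
  sum_n u (n + S p) = plus (sum_n u n) (sum_n (fun i => u (S n + i)%nat) p).
Proof.
induction p as [|p IH].
- replace (n + 1)%nat with (S n) by lia.
  rewrite sum_Sn, sum_O; do 2 f_equal; lia.
- replace (n + S (S p))%nat with (S (n + S p)) by lia.
  rewrite !sum_Sn, IH, plus_assoc; do 2 f_equal; lia.
Qed.

(** [sum_n] includes its upper index, so [S p * N + p] is the last index of [N + 1] full blocks of
    length [S p]; raising [N] by one appends one term to each residue class. *)
Lemma sum_n_residues {G : AbelianMonoid} (u : nat -> G) (p N : nat) :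
  sum_n u (S p * N + p) =
  sum_n (fun i => sum_n (fun m => u (S p * m + i)%nat) N) p.
Proof.
induction N as [|N IH].
- replace (S p * 0 + p)%nat with p by lia; apply sum_n_ext; intros i.
  rewrite sum_O; f_equal; lia.
- replace (S p * S N + p)%nat with ((S p * N + p) + S p)%nat by lia.
  rewrite sum_n_add, IH, <- sum_n_plus; apply sum_n_ext; intros i.
  rewrite sum_Sn; do 2 f_equal; lia.
Qed.

Lemma is_lim_seq_sum_n (u : nat -> nat -> R) (l : nat -> R) (p : nat) :
  (forall i, is_lim_seq (u i) (l i)) ->
  is_lim_seq (fun N => sum_n (fun i => u i N) p) (sum_n l p).
Proof.
intros H; induction p as [|p IH].
- rewrite sum_O; apply is_lim_seq_ext with (u O); [|apply H].
  intros N; now rewrite sum_O.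
- rewrite sum_Sn.
  apply is_lim_seq_ext with
    (fun N => (sum_n (fun i => u i N) p + u (S p) N)%R).
  + intros N; now rewrite sum_Sn.
  + apply is_lim_seq_plus'; [exact IH | apply H].
Qed.

(** Partial sums ending at full blocks form a subsequence, so they tend to the whole series, and
    they are also finite sums of partial sums of the classes. Convergence of each class is assumed
    because a conditionally convergent [u] does not provide it. *)
Lemma Series_residues (u : nat -> R) (p : nat) :
  ex_series u -> (forall i, ex_series (fun m => u (S p * m + i)%nat)) ->
  Series u = sum_n (fun i => Series (fun m => u (S p * m + i)%nat)) p.
Proof.
intros Hu Hi.
assert (L1 : is_lim_seq (fun N => sum_n u (S p * N + p)) (Series u)).
{ apply is_lim_seq_subseq with (u := sum_n u) (phi := fun N => (S p * N + p)%nat).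
  - apply eventually_subseq; intros n; lia.
  - exact (Series_correct _ Hu). }
assert (L2 := is_lim_seq_sum_n
  (fun i N => sum_n (fun m => u (S p * m + i)%nat) N) _ p
  (fun i => Series_correct _ (Hi i))).
apply is_lim_seq_unique in L1; apply is_lim_seq_unique in L2.
rewrite (Lim_seq_ext _ _ (sum_n_residues u p)), L2 in L1.
now injection L1.
Qed.

(** A form of absolute convergence that passes to arithmetic progressions and survives bounded
    factors such as signs. *)
Definition geom_bounded (u : nat -> C) : Prop :=
  exists M r : R, 0 <= r < 1 /\ forall n, (Cmod (u n) <= M * r ^ n)%R.

Lemma geom_bounded_subseq (u : nat -> C) (k i : nat) :
  (0 < k)%nat -> geom_bounded u -> geom_bounded (fun m => u (k * m + i)%nat).
Proof.
intros Hk (M & r & Hr & H).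
assert (HM : 0 <= M).
{ generalize (H O) (Cmod_ge_0 (u O)); simpl; lra. }
exists M, r; split; trivial; intros m.
apply Rle_trans with (1 := H _), Rmult_le_compat_l; trivial.
(* Since [k >= 1], the index is at least [m], and the surplus powers of [r] are at most 1. *)
replace (k * m + i)%nat with (m + ((k - 1) * m + i))%nat by nia.
rewrite pow_add; rewrite <- (Rmult_1_r (r ^ m)) at 2.
apply Rmult_le_compat_l; [apply pow_le; lra|].
rewrite <- (pow1 ((k - 1) * m + i)); apply pow_incr; lra.
Qed.

Lemma geom_bounded_mult (c u : nat -> C) (K : R) :
  (forall n, (Cmod (c n) <= K)%R) -> geom_bounded u ->
  geom_bounded (fun n => c n * u n).
Proof.
intros Hc (M & r & Hr & H); exists (K * M)%R, r; split; trivial; intros n.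
rewrite Cmod_mult, Rmult_assoc.
apply Rmult_le_compat; trivial; apply Cmod_ge_0.
Qed.

Lemma geom_bounded_ex_series (u : nat -> C) :
  geom_bounded u ->
  ex_series (fun n => Re (u n)) /\ ex_series (fun n => Im (u n)).
Proof.
intros (M & r & Hr & H).
assert (E : ex_series (fun n => M * r ^ n)%R).
{ apply (ex_series_scal_l M (fun n => r ^ n)%R), ex_series_geom.
  rewrite Rabs_right; lra. }
split; apply (ex_series_le (V := R_CompleteNormedModule)) with (2 := E);
  intros n; apply Rle_trans with (2 := H n).
- apply re_le_Cmod.
- apply Rle_trans with (2 := Rmax_Cmod (u n)), Rmax_r.
Qed.

Lemma Re_sum_n (u : nat -> C) (n : nat) :
  Re (sum_n u n) = sum_n (fun k => Re (u k)) n.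
Proof.
induction n as [|n IH]; [now rewrite !sum_O|].
now rewrite !sum_Sn, <- IH.
Qed.

Lemma Im_sum_n (u : nat -> C) (n : nat) :
  Im (sum_n u n) = sum_n (fun k => Im (u k)) n.
Proof.
induction n as [|n IH]; [now rewrite !sum_O|].
now rewrite !sum_Sn, <- IH.
Qed.

Lemma CSeries_ext (u v : nat -> C) :
  (forall n, u n = v n) -> CSeries u = CSeries v.
Proof.
intros H; unfold CSeries; f_equal; apply Series_ext; intros n; now rewrite H.
Qed.

(** Each component of [c * u n] mixes the real and imaginary parts of [u n], so splitting the series
    requires both to converge. *)
Lemma CSeries_scal (c : C) (u : nat -> C) :
  geom_bounded u -> CSeries (fun n => c * u n) = c * CSeries u.
Proof.
intros H; apply geom_bounded_ex_series in H; destruct H as [H1 H2].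
assert (S : forall (k : R) v, ex_series v -> ex_series (fun n => k * v n)%R)
  by (intros k v; apply (ex_series_scal_l k v)).
apply injective_projections; unfold CSeries, Cmult; cbn [fst snd];
  rewrite <- !Series_scal_l.
- rewrite <- Series_minus by now apply S.
  now apply Series_ext.
- rewrite <- Series_plus by now apply S.
  now apply Series_ext.
Qed.

Lemma CSeries_residues (u : nat -> C) (k : nat) :
  (0 < k)%nat -> geom_bounded u ->
  CSeries u = sum_n (fun i => CSeries (fun m => u (k * m + i)%nat)) (k - 1).
Proof.
intros Hk H; destruct k as [|p]; [lia|].
replace (S p - 1)%nat with p by lia.
assert (Hi := fun i => geom_bounded_ex_series _
  (geom_bounded_subseq u (S p) i Hk H)).
destruct (geom_bounded_ex_series u H) as [H1 H2].
apply injective_projections.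
- etransitivity; [|symmetry; apply Re_sum_n].
  apply (Series_residues (fun n => Re (u n))); trivial.
  intros i; apply Hi.
- etransitivity; [|symmetry; apply Im_sum_n].
  apply (Series_residues (fun n => Im (u n))); trivial.
  intros i; apply Hi.
Qed.

(** * Powers of [q] and the size of the terms *)

Lemma Cpow_Cexp (l : C) (n : nat) : Cexp l ^ n = Cexp (INR n * l).
Proof.
induction n as [|n IH].
- rewrite Cmult_0_l; unfold Cexp; cbn.
  rewrite exp_0, cos_0, sin_0; unfold RtoC; f_equal; ring.
- rewrite Cpow_S, IH, <- Cexp_plus, S_INR, RtoC_plus; f_equal; ring.
Qed.

Lemma INR_neq_0 (n : nat) : (0 < n)%nat -> RtoC (INR n) <> 0.
Proof.
intros Hn E; apply RtoC_inj in E; revert E; apply not_0_INR; lia.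
Qed.

Lemma Cpow_0_l (n : nat) : (0 < n)%nat -> (RtoC 0) ^ n = 0.
Proof. intros Hn; destruct n; [lia|]; rewrite Cpow_S; ring. Qed.

Lemma qpow_nat (q l : C) (n : nat) :
  is_log q l -> (0 < n)%nat -> qpow q l (INR n) = q ^ n.
Proof.
intros hl Hn; unfold qpow; destruct (Ceq_dec q 0) as [->|Hq].
- destruct (Ceq_dec _ _) as [E|_]; [now apply INR_neq_0 in E|].
  now rewrite Cpow_0_l.
- now rewrite <- Cpow_Cexp, hl.
Qed.

(** With [a * l] as logarithm of [q ^ a], no branch correction arises. For [q = 0] both sides only
    test whether the exponent vanishes, and [a * x = 0] exactly when [x = 0]. *)
Lemma qpow_base (q l : C) (a : nat) (x : C) :
  (0 < a)%nat -> qpow (q ^ a) (INR a * l) x = qpow q l (INR a * x).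
Proof.
intros Ha; unfold qpow.
destruct (Ceq_dec q 0) as [->|Hq].
- rewrite Cpow_0_l by easy.
  destruct (Ceq_dec 0 0) as [_|E]; [|easy].
  destruct (Ceq_dec x 0) as [->|Hx].
  + destruct (Ceq_dec _ _) as [_|E]; trivial; elim E; ring.
  + destruct (Ceq_dec _ _) as [E|_]; trivial.
    elim (Cmult_neq_0 (INR a) x); trivial; now apply INR_neq_0.
- destruct (Ceq_dec _ _) as [E|_].
  + now apply (Cpow_nz q a) in Hq.
  + f_equal; ring.
Qed.

(* At [z = 0] both sides are [0]: a term of the zeta series whose denominator
   vanishes is [0] on either side of the identity. *)
Lemma Cinv_Cdiv (z w : C) : w <> 0 -> / (z / w) = w / z.
Proof.
intros Hw; destruct (Ceq_dec z 0) as [->|Hz]; [|now field].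
replace (0 / w) with (RtoC 0) by (unfold Cdiv; ring).
assert (E : / (RtoC 0) = 0).
{ unfold Cinv, RtoC; cbn; f_equal; unfold Rdiv; ring. }
unfold Cdiv; rewrite E; ring.
Qed.

Lemma bounded_of_eventually (u : nat -> R) (M : R) (N : nat) :
  (forall n, (N <= n)%nat -> u n <= M) -> exists M', forall n, u n <= M'.
Proof.
revert M; induction N as [|N IH]; intros M H.
- exists M; intros n; apply H; lia.
- apply (IH (Rmax M (u N))); intros n Hn.
  destruct (Nat.eq_dec n N) as [->|].
  + apply Rmax_r.
  + apply Rle_trans with M; [apply H; lia | apply Rmax_l].
Qed.

(** The modulus of the inverse is the exponential of [- Re s * ln |1 - w| + Im s * Carg (1 - w)].
    Here [|1 - w|] lies between 1/2 and 2, and the argument is bounded because [1 - w] has positive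
    real part. *)
Lemma Cmod_inv_Cpower_near_1 (w s : C) :
  (Cmod w <= 1 / 2)%R ->
  (Cmod (/ Cpower (1 - w) s) <= exp (Rabs (Re s) * ln 2 + Rabs (Im s) * PI))%R.
Proof.
intros Hw.
assert (Hr := Re_1_minus_pos w ltac:(lra)).
assert (Hz : 1 - w <> 0) by (intros E; rewrite E in Hr; cbn in Hr; lra).
assert (H1 : (1 / 2 <= Cmod (1 - w))%R).
{ generalize (Cmod_triangle (1 - w) w).
  replace (1 - w + w) with (RtoC 1) by ring; rewrite Cmod_1; lra. }
assert (H2 : (Cmod (1 - w) <= 2)%R).
{ generalize (Cmod_triangle 1 (- w)); rewrite Cmod_opp, Cmod_1.
  unfold Cminus; lra. }
rewrite Cmod_inv by now apply Cpower_neq_0.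
unfold Cpower; destruct (Ceq_dec _ _) as [E|_]; [easy|].
rewrite Cmod_Cexp, <- exp_Ropp.
assert (L1 : ln (Cmod (1 - w)) <= ln 2) by (apply ln_le; lra).
assert (L2 : (- ln 2 <= ln (Cmod (1 - w)))%R).
{ rewrite <- ln_Rinv by lra; apply ln_le; lra. }
assert (La : (Rabs (ln (Cmod (1 - w))) <= ln 2)%R) by (apply Rabs_le; lra).
assert (Lb : (Rabs (Carg (1 - w)) <= PI)%R).
{ generalize (Carg_bound _ Hr) PI_RGT_0; intros; apply Rabs_le; lra. }
replace (- Re (s * Clog (1 - w)))%R with
  (- (Re s * ln (Cmod (1 - w))) + Im s * Carg (1 - w))%R
  by (unfold Clog, Re, Im; destruct s; cbn; ring).
assert (E1 := Rle_abs (- (Re s * ln (Cmod (1 - w))))).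
assert (E2 := Rle_abs (Im s * Carg (1 - w))).
rewrite Rabs_Ropp, Rabs_mult in E1; rewrite Rabs_mult in E2.
assert (F1 := Rmult_le_compat_l _ _ _ (Rabs_pos (Re s)) La).
assert (F2 := Rmult_le_compat_l _ _ _ (Rabs_pos (Im s)) Lb).
apply Rnot_lt_le; intros H; apply exp_lt_inv in H; lra.
Qed.

Definition zeta_term (q l s y : C) (k : nat) : C :=
  q ^ k / Cpower (1 - qpow q l (INR k + y)) s.

(** The factor [q ^ k] gives the decay. The inverse power stays bounded because [q ^ (k + y)] tends
    to 0, hence is eventually in the disc of radius 1/2; the finitely many earlier terms only
    enlarge the constant. *)
Lemma zeta_term_geom_bounded (q l s y : C) :
  (Cmod q < 1)%R -> is_log q l -> geom_bounded (zeta_term q l s y).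
Proof.
intros hq hl.
set (g := fun k : nat => Cmod (/ Cpower (1 - qpow q l (INR k + y)) s)).
assert (Hg : forall k, Cmod (zeta_term q l s y k) = (Cmod q ^ k * g k)%R).
{ intros k; unfold zeta_term, Cdiv; now rewrite Cmod_mult, Cmod_pow. }
destruct (Ceq_dec q 0) as [Hq|Hq].
(* For [q = 0] only the term [k = 0] survives, and its modulus is [g O]. *)
- exists (g O), (Cmod q); rewrite Hq, Cmod_0 in *; split; [lra|].
  intros k; rewrite Hg; destruct k as [|k]; simpl; lra.
- assert (Hb : exists M, forall k, g k <= M).
  { assert (Lim : is_lim_seq (fun k => Cmod q ^ k * exp (Re (y * l)))%R 0).
    { replace (Finite 0) with (Finite (0 * exp (Re (y * l))))
        by (f_equal; ring).
      apply is_lim_seq_mult'; [|apply is_lim_seq_const].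
      apply is_lim_seq_geom; rewrite Rabs_right; trivial.
      apply Rle_ge, Cmod_ge_0. }
    apply is_lim_seq_spec in Lim.
    assert (Hhalf : (0 < 1 / 2)%R) by lra.
    destruct (Lim (mkposreal _ Hhalf)) as [N HN]; cbn in HN.
    apply bounded_of_eventually with
      (exp (Rabs (Re s) * ln 2 + Rabs (Im s) * PI)) N.
    intros k Hk; apply Cmod_inv_Cpower_near_1.
    unfold qpow; destruct (Ceq_dec q 0) as [E|_]; [easy|].
    rewrite Cmult_plus_distr_r, Cexp_plus, <- Cpow_Cexp, hl by easy.
    rewrite Cmod_mult, Cmod_pow, Cmod_Cexp.
    specialize (HN k Hk); rewrite Rminus_0_r in HN.
    apply Rabs_def2 in HN; apply Rlt_le, HN. }
  destruct Hb as [M HM]; exists M, (Cmod q).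
  split; [split; [apply Cmod_ge_0|easy]|].
  intros k; rewrite Hg, Rmult_comm; apply Rmult_le_compat_r; trivial.
  apply pow_le, Cmod_ge_0.
Qed.

(** * The symmetric triple sum *)

Lemma Cmod_m1_pow (n : nat) : Cmod ((-1) ^ n) = 1%R.
Proof.
rewrite Cmod_pow, Cmod_R, Rabs_left by lra.
replace (- -1)%R with 1%R by lra; apply pow1.
Qed.

(** This is where parity matters: it gives [n = b * m + i] the sign [(-1) ^ (m + i)]. *)
Lemma m1_pow_odd_mult (b m : nat) : Nat.Odd b -> (RtoC (-1)) ^ (b * m) = (-1) ^ m.
Proof.
intros [k ->]; rewrite Cpow_mult_r, Cpow_add_r, Cpow_mult_r.
f_equal; rewrite Cpow_1_r.
replace ((RtoC (-1)) ^ 2) with (RtoC 1) by (cbn; ring).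
rewrite Cpow_1_l; ring.
Qed.

Definition residue_series (h : nat -> C) (a b i j : nat) : C :=
  CSeries (fun m => (-1) ^ (m + i + j) * h (a * b * m + a * i + b * j)%nat).

(** The symmetry holds term by term, so no infinite sum is rearranged. *)
Lemma residue_series_sym (h : nat -> C) (a b i j : nat) :
  residue_series h a b i j = residue_series h b a j i.
Proof.
apply CSeries_ext; intros m; f_equal; f_equal; lia.
Qed.

(** * Expansion of the zeta functions and the final identity *)

Lemma Cmod_lt_1_neq (z : C) : (Cmod z < 1)%R -> 1 - z <> 0.
Proof.
intros Hz E; apply Re_1_minus_pos in Hz; rewrite E in Hz; cbn in Hz; lra.
Qed.

Lemma Cmod_pow_lt_1 (q : C) (a : nat) :
  (Cmod q < 1)%R -> (0 < a)%nat -> (Cmod (q ^ a) < 1)%R.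
Proof.
intros hq Ha; rewrite Cmod_pow; apply pow_lt_1_compat; trivial.
split; [apply Cmod_ge_0|easy].
Qed.

(** Since [a * (n + b * x + b * j / a) = (a * n + b * j) + a * b * x], the zeta series for [q ^ a]
    samples the single family [zeta_term] of base [q] at the indices [a * n + b * j]. The factor
    [(1 - q ^ a) ^ s] comes from the denominator of [qnum_power]. *)
Lemma zetaE_expand (q l : C) (a b j : nat) (s x : C) :
  (Cmod q < 1)%R -> is_log q l -> Nat.Odd a -> Nat.Odd b ->
  (-1) ^ j * q ^ (b * j) *
    zetaE (q ^ a) (INR a * l) s (INR b * x + INR b * INR j / INR a) =
  qnum (q ^ a) (INR a * l) 2 * Cpower (1 - q ^ a) s *
    sum_n (fun i => residue_series
                      (zeta_term q l s (INR a * INR b * x)) a b i j) (b - 1).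
Proof.
intros hq hl Ha Hb.
assert (Ha0 : (0 < a)%nat) by (destruct Ha; lia).
assert (Hb0 : (0 < b)%nat) by (destruct Hb; lia).
assert (hqa := Cmod_pow_lt_1 q a hq Ha0).
assert (HP := Cpower_neq_0 _ s (Cmod_lt_1_neq _ hqa)).
assert (Hh := zeta_term_geom_bounded q l s (INR a * INR b * x) hq hl).
set (h := zeta_term q l s (INR a * INR b * x)) in *.
assert (signs : forall k w, geom_bounded w ->
  geom_bounded (fun n => (-1) ^ (n + k) * w n)).
{ intros k w; apply (geom_bounded_mult (fun n => (-1) ^ (n + k)) _ 1).
  intros n; rewrite Cmod_m1_pow; lra. }
(* In [w] the shift [b * j] sits in the argument of [zeta_term]; multiplying by [q ^ (b * j)] moves
   it into the index, which gives [v]. The [+ 0] matches the shape of [signs] and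
   [geom_bounded_subseq]. *)
set (w := fun n => (-1) ^ (n + 0) *
  zeta_term q l s (INR (b * j) + INR a * INR b * x) (a * n + 0)).
assert (Hw : geom_bounded w).
{ apply (signs O), geom_bounded_subseq; trivial.
  now apply zeta_term_geom_bounded. }
set (v := fun n => (-1) ^ (n + j) * h (a * n + b * j)%nat).
assert (Hv : geom_bounded v) by now apply signs, (geom_bounded_subseq h).
assert (Hwv : forall n, (-1) ^ j * q ^ (b * j) * w n = v n).
{ intros n; unfold w, v, h, zeta_term.
  rewrite !Nat.add_0_r, plus_INR, RtoC_plus, <- !Cplus_assoc, !Cpow_add_r.
  unfold Cdiv; ring. }
unfold zetaE.
rewrite (CSeries_ext _ (fun n => Cpower (1 - q ^ a) s * w n)).
2:{ intros n; unfold w, zeta_term, qnum_power.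
  rewrite qpow_base, !Nat.add_0_r by easy.
  replace (INR a * (INR n + (INR b * x + INR b * INR j / INR a)))
    with (INR (a * n) + (INR (b * j) + INR a * INR b * x))
    by (rewrite !mult_INR, !RtoC_mult; field; now apply INR_neq_0).
  unfold Cdiv at 1; rewrite Cinv_Cdiv, <- Cpow_mult_r by easy.
  unfold Cdiv; ring. }
rewrite CSeries_scal by easy.
transitivity (qnum (q ^ a) (INR a * l) 2 * Cpower (1 - q ^ a) s *
  ((-1) ^ j * q ^ (b * j) * CSeries w)); [ring|].
rewrite <- CSeries_scal, (CSeries_ext _ v Hwv) by easy.
rewrite (CSeries_residues v b Hb0 Hv); f_equal.
apply sum_n_ext; intros i; apply CSeries_ext; intros m; unfold v; f_equal.
(* Sign at [n = b * m + i], using that [b] is odd. *)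
- rewrite !Cpow_add_r, m1_pow_odd_mult by easy; easy.
- f_equal; ring.
Qed.

Theorem theorem2p1 (q l : C) (hq : (Cmod q < 1)%R) (hl : is_log q l)
    (a b : nat) (ha : Nat.Odd a) (hb : Nat.Odd b) (s x : C)
    (hxa : forall j n : nat, (j < a)%nat ->
       INR b * x + INR b * INR j / INR a <> - INR n)
    (hxb : forall j n : nat, (j < b)%nat ->
       INR a * x + INR a * INR j / INR b <> - INR n) :
  qnum (q ^ b) (INR b * l) 2 * qnum_power q l (INR b) s *
    sum_n (fun j : nat => (-1) ^ j * q ^ (b * j) *
             zetaE (q ^ a) (INR a * l) s
               (INR b * x + INR b * INR j / INR a)) (a - 1)
  = qnum (q ^ a) (INR a * l) 2 * qnum_power q l (INR a) s *
    sum_n (fun j : nat => (-1) ^ j * q ^ (a * j) *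
             zetaE (q ^ b) (INR b * l) s
               (INR a * x + INR a * INR j / INR b)) (b - 1).
Proof.
assert (ha0 : (0 < a)%nat) by (destruct ha; lia).
assert (hb0 : (0 < b)%nat) by (destruct hb; lia).
(* The numerator of [[b]_q ^ s] is the factor [(1 - q ^ b) ^ s] that the expansion produces on the
   other side, and likewise for [a]; both sides thus get the same prefactor over [(1 - q) ^ s]. *)
unfold qnum_power; rewrite !qpow_nat by easy.
rewrite (sum_n_ext _ _ _ (fun j => zetaE_expand q l a b j s x hq hl ha hb)).
rewrite (sum_n_ext _ _ _ (fun j => zetaE_expand q l b a j s x hq hl hb ha)).
rewrite !(sum_n_mult_l (K := C_Ring)).
rewrite (sum_n_switch (fun j i => residue_series _ b a i j)).
replace (INR b * INR a * x) with (INR a * INR b * x) by ring.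
rewrite (sum_n_ext _ (fun j => sum_n (fun i =>
  residue_series (zeta_term q l s (INR a * INR b * x)) b a j i) (b - 1)) (a - 1)).
2:{ intros j; apply sum_n_ext; intros i; apply residue_series_sym. }
change (@mult C_Ring) with Cmult.
field.
apply Cpower_neq_0, Cmod_lt_1_neq, hq.
Qed.
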